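(* Let $\mathbb S$ be an S-graph all of whose vertices are interior, and let $n$ be an integer compatible with $\mathbb S$. Suppose that either $n$ is odd or that $\mathbb S$ is orientable. Then the graded algebra $A(\mathbb S,n)$ is $n$-Calabi–Yau.
   Context: Fix a field $\mathbf k$. An S-graph with only interior vertices is a finite graph $\mathbb S$ (loops and multiple edges allowed) with a cyclic order on the set of halfedges at each vertex and an integer $d(i,i+1)>0$ for each pair $(i,i+1)$ of successive halfedges at a vertex ($i+1$ denotes the successor of $i$; at a 1-valent vertex $i+1=i$). The degree $\deg(v)$ of a vertex is the sum of $d(i,i+1)$ over all successive pairs at $v$. An integer $n$ is compatible with $\mathbb S$ if it is a positive multiple of the degrees of all vertices. The relative graded Brauer graph algebra $A(\mathbb S,n)$ is in this case the graded algebra given by the quiver whose vertices are the edges of $\mathbb S$, with an arrow $a_i$ from (the edge of) $i$ to (the edge of) $i+1$ of degree $d(i,i+1)$ for each pair of successive halfedges, subject to the relations: $a_ja_i=0$ if $i+1\neq j$ are halfedges belonging to the same edge; and for each edge $\{i,j\}$: $c_i=(-1)^{n-1}c_j$, where $c_i=(a_{i-1}a_{i-2}\cdots a_{i+1}a_i)^{n/m}$ is the cycle at $i$ going $n/m$ times around the vertex $v$ of $i$, $m=\deg(v)$. (The differential vanishes.) $\mathbb S$ is orientable if there is an orientation of its edges such that for any two consecutive halfedges $i,i+1$, $d(i,i+1)$ is even (resp. odd) if $i$ and $i+1$ both point towards or both point away from the vertex (resp. point in different directions); for a 1-valent vertex the condition is instead that it has even degree. A finite-dimensional graded $\mathbf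 k$-algebra $A$ is $n$-Calabi–Yau if there is a linear functional $\mathrm{tr}:A^n\to\mathbf k$ on the degree $n$ part (extended by zero to $A$) which is symmetric, $\mathrm{tr}(ab)=(-1)^{|a||b|}\mathrm{tr}(ba)$, and non-degenerate, i.e. $(a,b)\mapsto\mathrm{tr}(ab)$ is a non-degenerate pairing on $A$. *)

(* Defs.v *)
From HB Require Import structures.
From mathcomp Require Import all_boot all_order all_algebra all_fingroup.
From mathcomp Require Import generic_quotient ring_quotient.
From mathcomp Require Import finmap boolp monalg.

Set Implicit Arguments.
Unset Strict Implicit.
Unset Printing Implicit Defensive.

Import Order.TTheory GRing.Theory Num.Theory.
Local Open Scope ring_scope.
Local Open Scope quotient_scope.

(* [algType] requires 1 != 0, whereas the path algebra of the empty quiver is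
   the zero ring; hence this variant over [pzRingType].  The product is part of
   the mixin since [HB] cannot join [PzRing] and [Lmodule] after the fact. *)
HB.mixin Record Lmodule_isPzAlg (k : pzRingType) A of GRing.Lmodule k A := {
  aone : A;
  amul : A -> A -> A;
  amulA : associative amul;
  amul1l : left_id aone amul;
  amul1r : right_id aone amul;
  amulDl : left_distributive amul +%R;
  amulDr : right_distributive amul +%R;
  amulZl : forall (c : k) (x y : A), amul (c *: x) y = c *: amul x y;
  amulZr : forall (c : k) (x y : A), amul x (c *: y) = c *: amul x y
}.

#[short(type="pzAlgType")]
HB.structure Definition PzAlg (k : pzRingType) :=
  {A of GRing.Lmodule k A & Lmodule_isPzAlg k A}.

HB.instance Definition _ (k : pzRingType) (A : pzAlgType k) :=
  GRing.Zmodule_isPzRing.Build A amulA amul1l amul1r amulDl amulDr.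

Lemma pzscalerAl (k : pzRingType) (A : pzAlgType k) (c : k) (x y : A) :
  (c *: x) * y = c *: (x * y).
Proof. exact: amulZl. Qed.

Lemma pzscalerAr (k : pzRingType) (A : pzAlgType k) (c : k) (x y : A) :
  x * (c *: y) = c *: (x * y).
Proof. exact: amulZr. Qed.

(* The last two fields say that A is the direct sum of its pieces. *)
Record grading (k : pzRingType) (A : pzAlgType k) := Grading {
  piece :> int -> A -> Prop;
  piece0 : forall e, piece e 0;
  pieceD : forall e x y, piece e x -> piece e y -> piece e (x + y);
  pieceZ : forall e (c : k) x, piece e x -> piece e (c *: x);
  piece1 : piece 0 1;
  pieceM : forall e f x y, piece e x -> piece f y -> piece (e + f) (x * y);
  piece_sum : forall x, exists (s : seq int) (c : int -> A),
    (forall e, piece e (c e)) /\ x = \sum_(e <- s) c e;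
  piece_direct : forall (s : seq int) (c : int -> A), uniq s ->
    (forall e, piece e (c e)) -> \sum_(e <- s) c e = 0 ->
    forall e, e \in s -> c e = 0
}.

Definition finite_dim (k : pzRingType) (V : lmodType k) : Prop :=
  exists s : seq V, forall x, exists c : 'I_(size s) -> k,
    x = \sum_i c i *: s`_i.

(* A functional on the piece of degree n, extended by zero, is a functional on
   A vanishing on all the other pieces. *)
Definition calabi_yau (k : fieldType) (n : int) (A : pzAlgType k)
    (G : grading A) : Prop :=
  finite_dim A /\
  exists tr : {scalar A},
    [/\ forall e a, e != n -> G e a -> tr a = 0,
        forall p q (a b : A), G p a -> G q b ->
          tr (a * b) = (-1) ^ (p * q) * tr (b * a),
        forall a, (forall b, tr (a * b) = 0) -> a = 0
      & forall b, (forall a, tr (a * b) = 0) -> b = 0].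

Section LinearExtension.
Variables (k : nzRingType) (K : choiceType).
Implicit Types u v : {malg k[K]}.

Definition malg_ext (V : lmodType k) (F : K -> V) u : V :=
  \sum_(p <- msupp u) u@_p *: F p.

Lemma malg_extEw (V : lmodType k) (F : K -> V) u (D : {fset K}) :
  (msupp u `<=` D)%fset -> malg_ext F u = \sum_(p <- D) u@_p *: F p.
Proof.
move=> sub; rewrite /malg_ext (big_fset_incl _ sub) //= => p _ pNu.
by rewrite mcoeff_outdom ?scale0r.
Qed.

Lemma malg_ext_is_linear (V : lmodType k) (F : K -> V) : linear (malg_ext F).
Proof.
move=> c u v; pose D := (msupp (c *: u + v) `|` (msupp u `|` msupp v))%fset.
rewrite (@malg_extEw _ _ u D) ?(@malg_extEw _ _ v D) ?(@malg_extEw _ _ _ D).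
- rewrite scaler_sumr -big_split; apply: eq_bigr => p _ /=.
  by rewrite mcoeffD mcoeffZ scalerDl scalerA.
- exact: fsubsetUl.
- by apply: fsubset_trans (fsubsetUr _ _); exact: fsubsetUr.
- by apply: fsubset_trans (fsubsetUr _ _); exact: fsubsetUl.
Qed.

HB.instance Definition _ (V : lmodType k) (F : K -> V) :=
  GRing.isLinear.Build k {malg k[K]} V *:%R (malg_ext F) (malg_ext_is_linear F).

Lemma malg_extD (V : lmodType k) (F : K -> V) u v :
  malg_ext F (u + v) = malg_ext F u + malg_ext F v.
Proof. exact: linearD. Qed.

Lemma malg_extZ (V : lmodType k) (F : K -> V) c u :
  malg_ext F (c *: u) = c *: malg_ext F u.
Proof. exact: linearZ. Qed.

Lemma malg_ext0 (V : lmodType k) (F : K -> V) : malg_ext F 0 = 0.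
Proof. exact: linear0. Qed.

Lemma malg_ext_funD (V : lmodType k) (F G H : K -> V) u :
  (forall p, F p = G p + H p) -> malg_ext F u = malg_ext G u + malg_ext H u.
Proof.
move=> FE; rewrite /malg_ext -big_split; apply: eq_bigr => p _ /=.
by rewrite FE scalerDr.
Qed.

Lemma malg_extU (V : lmodType k) (F : K -> V) p : malg_ext F << p >> = F p.
Proof.
by rewrite (@malg_extEw _ _ _ [fset p]%fset) ?msuppU_le // big_seq_fset1
   mcoeffUU scale1r.
Qed.

Lemma malg_ext_funZ (V : lmodType k) (F G : K -> V) c u :
  (forall x y : k, x * y = y * x) -> (forall p, F p = c *: G p) ->
  malg_ext F u = c *: malg_ext G u.
Proof.
move=> kC FE; rewrite /malg_ext scaler_sumr; apply: eq_bigr => p _ /=.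
by rewrite FE !scalerA kC.
Qed.

Lemma malg_ind (P : {malg k[K]} -> Prop) :
    P 0 -> (forall u v, P u -> P v -> P (u + v)) ->
    (forall c u, P u -> P (c *: u)) -> (forall p, P << p >>) ->
  forall u, P u.
Proof.
move=> P0 PD PZ PU u; rewrite [u]monalgE; elim/big_ind: _ => // p _.
suff -> : << u@_p *g p >> = u@_p *: << p >> :> {malg k[K]} by exact/PZ/PU.
by apply/malgP => q; rewrite mcoeffZ !mcoeffU mulr_natr.
Qed.

End LinearExtension.

Record quiver := Quiver {
  qvert : finType;
  qarr : finType;
  qsrc : qarr -> qvert;
  qtgt : qarr -> qvert;
  qdeg : qarr -> int
}.

Section Paths.
Variable (Q : quiver).

Fixpoint is_walk (v : qvert Q) (s : seq (qarr Q)) : bool :=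
  if s is a :: s' then (qsrc a == v) && is_walk (qtgt a) s' else true.

Definition walk_end (v : qvert Q) (s : seq (qarr Q)) : qvert Q :=
  last v (map (@qtgt Q) s).

(* A starting vertex and the list of arrows in the order of traversal. *)
Definition is_path (x : qvert Q * seq (qarr Q)) : bool := is_walk x.1 x.2.
Definition qpath := {x | is_path x}.

Implicit Types p q r : qpath.

Definition pstart p : qvert Q := (val p).1.
Definition parrs p : seq (qarr Q) := (val p).2.
Definition pend p : qvert Q := walk_end (pstart p) (parrs p).
Definition pdeg p : int := \sum_(a <- parrs p) qdeg a.

Definition pnil (v : qvert Q) : qpath :=
  exist is_path (v, [::]) isT.

Lemma parr_subproof (a : qarr Q) : is_path (qsrc a, [:: a]).
Proof. by rewrite /is_path /= eqxx. Qed.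

Definition parr (a : qarr Q) : qpath :=
  exist is_path (qsrc a, [:: a]) (parr_subproof a).

Lemma is_walk_cat v s t :
  is_walk v (s ++ t) = is_walk v s && is_walk (walk_end v s) t.
Proof. by elim: s v => //= a s IH v; rewrite IH andbA. Qed.

Lemma walk_end_cat v s t : walk_end v (s ++ t) = walk_end (walk_end v s) t.
Proof. by rewrite /walk_end map_cat last_cat. Qed.

(* [p] after [q]: as for maps, the right factor is traversed first. *)
Definition pcomp p q : option qpath :=
  if pend q == pstart p then insub (pstart q, parrs q ++ parrs p) else None.

Variant pcomp_spec p q : option qpath -> Type :=
| PcompSome r of pend q = pstart p & pstart r = pstart q
    & parrs r = parrs q ++ parrs p & pend r = pend p : pcomp_spec p q (Some r)
| PcompNone of pend q != pstart p : pcomp_spec p q None.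

Lemma pcompP p q : pcomp_spec p q (pcomp p q).
Proof.
rewrite /pcomp; case: eqP => [e|/eqP ne]; last by constructor.
have w : is_path (pstart q, parrs q ++ parrs p).
  rewrite /is_path is_walk_cat; apply/andP; split; first exact: (valP q).
  by move: e; rewrite /pend => ->; exact: (valP p).
rewrite (insubT is_path w); constructor=> //.
by rewrite /pend -e; exact: walk_end_cat.
Qed.

Lemma qpath_eq p q : pstart p = pstart q -> parrs p = parrs q -> p = q.
Proof.
by case: p q => [[v s] ?] [[w t] ?] /= vw st; apply: val_inj; congr pair.
Qed.

Lemma pcompA p q r :
  obind (fun x => pcomp p x) (pcomp q r) = obind (fun x => pcomp x r) (pcomp p q).
Proof.
case: (pcompP q r) => [x e1 s1 a1 f1|n1]; case: (pcompP p q) => [y e2 s2 a2 f2|n2] //=.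
- case: (pcompP p x) => [z e3 s3 a3 f3|]; last by rewrite f1 e2 eqxx.
  case: (pcompP y r) => [t e4 s4 a4 f4|]; last by rewrite s2 e1 eqxx.
  by congr Some; apply: qpath_eq; [rewrite s3 s4 | rewrite a3 a4 a1 a2 catA].
- by case: (pcompP p x) => // z; rewrite f1 => e; rewrite e eqxx in n2.
- by case: (pcompP y r) => // z; rewrite s2 => e; rewrite e eqxx in n1.
Qed.

End Paths.

Definition pathalg (Q : quiver) (k : fieldType) : Type := {malg k[qpath Q]}.
HB.instance Definition _ Q k := Choice.on (pathalg Q k).

(* The operations of [{malg k[qpath Q]}], locked since unification otherwise
   unfolds them without end. *)
HB.lock Definition pathalg_zero (Q : quiver) (k : fieldType) : pathalg Q k := 0 : {malg k[qpath Q]}.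
HB.lock Definition pathalg_opp (Q : quiver) (k : fieldType) (u : pathalg Q k) : pathalg Q k :=
  - (u : {malg k[qpath Q]}).
HB.lock Definition pathalg_add (Q : quiver) (k : fieldType) (u v : pathalg Q k) : pathalg Q k :=
  (u : {malg k[qpath Q]}) + v.
HB.lock Definition pathalg_scale (Q : quiver) (k : fieldType) (c : k) (u : pathalg Q k) : pathalg Q k :=
  c *: (u : {malg k[qpath Q]}).

Section PathAlgebraModule.
Variables (Q : quiver) (k : fieldType).
Implicit Types (u v w : pathalg Q k).

Fact pathalg_addA : associative (@pathalg_add Q k).
Proof. by move=> u v w; rewrite unlock; exact: addrA. Qed.

Fact pathalg_addC : commutative (@pathalg_add Q k).
Proof. by move=> u v; rewrite unlock; exact: addrC. Qed.

Fact pathalg_add0 : left_id (pathalg_zero Q k) (@pathalg_add Q k).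
Proof. by move=> u; rewrite !unlock; exact: add0r. Qed.

Fact pathalg_addN :
  left_inverse (pathalg_zero Q k) (@pathalg_opp Q k) (@pathalg_add Q k).
Proof. by move=> u; rewrite !unlock; exact: addNr. Qed.

HB.instance Definition _ := GRing.isZmodule.Build (pathalg Q k)
  pathalg_addA pathalg_addC pathalg_add0 pathalg_addN.

Fact pathalg_scaleA (a b : k) u :
  pathalg_scale a (pathalg_scale b u) = pathalg_scale (a * b) u.
Proof. by rewrite unlock; exact: scalerA. Qed.

Fact pathalg_scale1 : left_id 1 (@pathalg_scale Q k).
Proof. by move=> u; rewrite unlock; exact: scale1r. Qed.

Fact pathalg_scaleDr : right_distributive (@pathalg_scale Q k) +%R.
Proof.
by move=> a u v; rewrite /GRing.add /= !unlock; exact: scalerDr.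
Qed.

Fact pathalg_scaleDl u : {morph (@pathalg_scale Q k)^~ u : a b / a + b}.
Proof.
by move=> a b; rewrite {2}/GRing.add /= !unlock; exact: scalerDl.
Qed.

HB.instance Definition _ := GRing.Zmodule_isLmodule.Build k (pathalg Q k)
  pathalg_scaleA pathalg_scale1 pathalg_scaleDr pathalg_scaleDl.

Lemma pathalg0E : 0 = (0 : {malg k[qpath Q]}) :> pathalg Q k.
Proof. by rewrite -[LHS]/(pathalg_zero Q k) unlock. Qed.

Lemma pathalgDE u v : u + v = (u : {malg k[qpath Q]}) + v :> pathalg Q k.
Proof. by rewrite -[LHS]/(pathalg_add u v) unlock. Qed.

Lemma pathalgZE c u : c *: u = c *: (u : {malg k[qpath Q]}) :> pathalg Q k.
Proof. by rewrite -[LHS]/(pathalg_scale c u) unlock. Qed.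

(* The coefficient of the path [p]. *)
Definition pcoef (p : qpath Q) u : k := (u : {malg k[qpath Q]})@_p.

Lemma pathalgP u v : (forall p, pcoef p u = pcoef p v) -> u = v.
Proof. by move=> h; apply/malgP. Qed.

Lemma pcoef0 p : pcoef p 0 = 0.
Proof. by rewrite /pcoef pathalg0E; exact: mcoeff0. Qed.

Lemma pcoefD p u v : pcoef p (u + v) = pcoef p u + pcoef p v.
Proof. by rewrite /pcoef (pathalgDE u v); exact: mcoeffD. Qed.

Lemma pcoefZ p c u : pcoef p (c *: u) = c * pcoef p u.
Proof. by rewrite /pcoef (pathalgZE c u); exact: mcoeffZ. Qed.

Lemma pcoef_sum p (I : Type) (s : seq I) (P : pred I) (F : I -> pathalg Q k) :
  pcoef p (\sum_(i <- s | P i) F i) = \sum_(i <- s | P i) pcoef p (F i).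
Proof. exact: (big_morph _ (pcoefD p) (pcoef0 p)). Qed.

Lemma pathalg_extD (V : lmodType k) (F : qpath Q -> V) u v :
  malg_ext F (u + v) = malg_ext F u + malg_ext F v.
Proof. by rewrite (pathalgDE u v); exact: malg_extD. Qed.

Lemma pathalg_extZ (V : lmodType k) (F : qpath Q -> V) c u :
  malg_ext F (c *: u) = c *: malg_ext F u.
Proof. by rewrite (pathalgZE c u); exact: malg_extZ. Qed.

Lemma pathalg_ext0 (V : lmodType k) (F : qpath Q -> V) :
  malg_ext F (0 : pathalg Q k) = 0.
Proof. by rewrite pathalg0E; exact: malg_ext0. Qed.

End PathAlgebraModule.

HB.lock Definition pbasis (Q : quiver) (k : fieldType) (p : qpath Q) :
  pathalg Q k := << p >>.

Definition pbasis_mul (Q : quiver) (k : fieldType) (p q : qpath Q) :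
  pathalg Q k := oapp (pbasis k) 0 (pcomp p q).

HB.lock Definition pathalg_mul (Q : quiver) (k : fieldType) (u v : pathalg Q k) :
    pathalg Q k :=
  malg_ext (fun p => malg_ext (fun q => pbasis_mul k p q) v : pathalg Q k) u.

Section PathAlgebra.
Variables (Q : quiver) (k : fieldType).
Implicit Types p q r : qpath Q.

Local Notation pathalg := (pathalg Q k).
Local Notation pbasis := (@pbasis Q k).
Local Notation pbasis_mul := (@pbasis_mul Q k).
Local Notation pathalg_mul := (@pathalg_mul Q k).

Definition pathalg_one : pathalg := \sum_v pbasis (pnil v).

Implicit Types (u v w : pathalg).

Lemma pathalg_mulE u v : pathalg_mul u v =
  malg_ext (fun p => malg_ext (fun q => pbasis_mul p q) v : pathalg) u.
Proof. by rewrite unlock. Qed.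

Lemma pbasisE p : pbasis p = << p >> :> {malg k[qpath Q]}.
Proof. by rewrite unlock. Qed.

Lemma pcoefU p q : pcoef q (pbasis p) = (p == q)%:R.
Proof. by rewrite /pcoef pbasisE mcoeffU. Qed.

Lemma pathalg_ind (P : pathalg -> Prop) :
    P 0 -> (forall u v, P u -> P v -> P (u + v)) ->
    (forall c u, P u -> P (c *: u)) -> (forall p, P (pbasis p)) ->
  forall u, P u.
Proof.
move=> P0 PD PZ PU; apply: malg_ind => [|u v hu hv|c u hu|p].
- by move: P0; rewrite pathalg0E.
- by move: (PD u v hu hv); rewrite (pathalgDE u v).
- by move: (PZ c u hu); rewrite (pathalgZE c u).
- by rewrite -pbasisE; exact: PU.
Qed.

Lemma pathalg_mulDl : left_distributive pathalg_mul +%R.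
Proof. by move=> u v w; rewrite !pathalg_mulE; exact: pathalg_extD. Qed.

Lemma pathalg_mulZl c u v : pathalg_mul (c *: u) v = c *: pathalg_mul u v.
Proof. by rewrite !pathalg_mulE; exact: pathalg_extZ. Qed.

Lemma pathalg_mul0l v : pathalg_mul 0 v = 0.
Proof. by rewrite pathalg_mulE; exact: pathalg_ext0. Qed.

Lemma pathalg_mulDr : right_distributive pathalg_mul +%R.
Proof.
move=> u v w; rewrite !pathalg_mulE.
by apply: malg_ext_funD => p; exact: pathalg_extD.
Qed.

Lemma pathalg_mulZr c u v : pathalg_mul u (c *: v) = c *: pathalg_mul u v.
Proof.
by rewrite !pathalg_mulE; apply: malg_ext_funZ => [|p]; [exact: mulrC | exact: pathalg_extZ].
Qed.

Lemma pathalg_mul0r u : pathalg_mul u 0 = 0.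
Proof. by have := pathalg_mulZr 0 u 0; rewrite !scale0r. Qed.

Lemma pathalg_mulU p q : pathalg_mul (pbasis p) (pbasis q) = pbasis_mul p q.
Proof. by rewrite pathalg_mulE !pbasisE !malg_extU. Qed.

Lemma pathalg_mulA : associative pathalg_mul.
Proof.
move=> u v w; elim/pathalg_ind: u => [|u u' IH IH'|c u IH|p].
- by rewrite !pathalg_mul0l.
- by rewrite 3!pathalg_mulDl IH IH'.
- by rewrite 3!pathalg_mulZl IH.
elim/pathalg_ind: v => [|u u' IH IH'|c u IH|q].
- by rewrite pathalg_mul0l !pathalg_mul0r pathalg_mul0l.
- rewrite [pathalg_mul (u + u') _]pathalg_mulDl.
  by rewrite 2!(pathalg_mulDr (pbasis p)) IH IH' pathalg_mulDl.
- rewrite [pathalg_mul (c *: u) _]pathalg_mulZl.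
  by rewrite 2!(pathalg_mulZr c (pbasis p)) IH pathalg_mulZl.
elim/pathalg_ind: w => [|u u' IH IH'|c u IH|r].
- by rewrite !pathalg_mul0r.
- by rewrite (pathalg_mulDr (pbasis q)) 2!pathalg_mulDr IH IH'.
- by rewrite (pathalg_mulZr c (pbasis q)) 2!pathalg_mulZr IH.
rewrite !pathalg_mulU /pbasis_mul; have := pcompA p q r.
case: (pcomp q r) => [x|]; case: (pcomp p q) => [y|] /=;
  rewrite ?pathalg_mul0l ?pathalg_mul0r ?pathalg_mulU /pbasis_mul //.
- by move=> ->.
- by move=> ->.
- by move=> <-.
Qed.

Lemma pathalg_mul1l : left_id pathalg_one pathalg_mul.
Proof.
elim/pathalg_ind => [|u u' IH IH'|c u IH|p].
- by rewrite pathalg_mul0r.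
- by rewrite pathalg_mulDr IH IH'.
- by rewrite pathalg_mulZr IH.
rewrite /pathalg_one (big_morph (pathalg_mul^~ _)
  (fun x y => pathalg_mulDl x y _) (pathalg_mul0l _)).
rewrite (bigD1 (pend p)) //= big1 => [|v vp]; rewrite pathalg_mulU /pbasis_mul.
  rewrite addr0; case: pcompP => [r _ s a _|]; last by rewrite eqxx.
  by congr pbasis; apply: qpath_eq => //; rewrite a cats0.
by case: pcompP => // r e; rewrite e eqxx in vp.
Qed.

Lemma pathalg_mul1r : right_id pathalg_one pathalg_mul.
Proof.
elim/pathalg_ind => [|u u' IH IH'|c u IH|p].
- by rewrite pathalg_mul0l.
- by rewrite pathalg_mulDl IH IH'.
- by rewrite pathalg_mulZl IH.
rewrite /pathalg_one (big_morph (pathalg_mul _)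
  (fun x y => pathalg_mulDr _ x y) (pathalg_mul0r _)).
rewrite (bigD1 (pstart p)) //= big1 => [|v vp]; rewrite pathalg_mulU /pbasis_mul.
  rewrite addr0; case: pcompP => [r _ s a _|]; last by rewrite eqxx.
  by congr pbasis; apply: qpath_eq => //; rewrite s.
by case: pcompP => // r e; rewrite -e eqxx in vp.
Qed.

HB.instance Definition _ := GRing.Zmodule_isPzRing.Build pathalg
  pathalg_mulA pathalg_mul1l pathalg_mul1r pathalg_mulDl pathalg_mulDr.
HB.instance Definition _ := Lmodule_isPzAlg.Build k pathalg
  pathalg_mulA pathalg_mul1l pathalg_mul1r pathalg_mulDl pathalg_mulDr
  pathalg_mulZl pathalg_mulZr.

Definition arrow (a : qarr Q) : pathalg := pbasis (parr a).


Definition pathalg_piece (e : int) u : Prop :=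
  forall p, pcoef p u != 0 -> pdeg p = e.

Lemma pathalg_pieceP e u :
  pathalg_piece e u <-> forall p, pdeg p != e -> pcoef p u = 0.
Proof.
split=> h p; first by move=> pe; apply/eqP; apply: contraNT pe => /h ->.
by move=> nz; apply/eqP; apply: contraNT nz => /h ->.
Qed.

Lemma pathalg_piece0 e : pathalg_piece e 0.
Proof. by apply/pathalg_pieceP => p _; rewrite pcoef0. Qed.

Lemma pathalg_pieceD e u v :
  pathalg_piece e u -> pathalg_piece e v -> pathalg_piece e (u + v).
Proof.
move=> /pathalg_pieceP hu /pathalg_pieceP hv; apply/pathalg_pieceP => p pe.
by rewrite pcoefD hu // hv // addr0.
Qed.

Lemma pathalg_pieceZ e c u : pathalg_piece e u -> pathalg_piece e (c *: u).
Proof.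
move=> /pathalg_pieceP hu; apply/pathalg_pieceP => p pe.
by rewrite pcoefZ hu // mulr0.
Qed.

Lemma pathalg_pieceU p : pathalg_piece (pdeg p) (pbasis p).
Proof.
by move=> q; rewrite pcoefU; have [->|_] := eqVneq p q; rewrite ?eqxx.
Qed.

Lemma pathalg_piece_sum e (I : Type) (s : seq I) (P : pred I) (F : I -> pathalg) :
  (forall i, P i -> pathalg_piece e (F i)) ->
  pathalg_piece e (\sum_(i <- s | P i) F i).
Proof.
move=> h; elim/big_ind: _ => //; first exact: pathalg_piece0.
by move=> x y; exact: pathalg_pieceD.
Qed.

Lemma pathalg_piece1 : pathalg_piece 0 1.
Proof.
apply: pathalg_piece_sum => v _; suff <- : pdeg (pnil v) = 0.
  exact: pathalg_pieceU.
by rewrite /pdeg big_nil.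
Qed.

Lemma pathalg_pieceM e f u v :
  pathalg_piece e u -> pathalg_piece f v -> pathalg_piece (e + f) (u * v).
Proof.
move=> hu hv; rewrite [u * v]pathalg_mulE /malg_ext big_seq.
apply: pathalg_piece_sum => p pu; apply: pathalg_pieceZ.
rewrite big_seq; apply: pathalg_piece_sum => q qv; apply: pathalg_pieceZ.
rewrite /pbasis_mul; case: pcompP => [r _ _ a _|_] /=; last first.
  exact: pathalg_piece0.
suff -> : e + f = pdeg r by exact: pathalg_pieceU.
have [<- <-] : pdeg p = e /\ pdeg q = f.
  by split; [apply: hu | apply: hv]; rewrite /pcoef mcoeff_neq0.
by rewrite /pdeg a big_cat addrC.
Qed.

Definition pathalg_proj (e : int) u : pathalg :=
  malg_ext (fun p => if pdeg p == e then pbasis p else 0 : pathalg) u.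

Lemma pathalg_projD e u v :
  pathalg_proj e (u + v) = pathalg_proj e u + pathalg_proj e v.
Proof. exact: pathalg_extD. Qed.

Lemma pathalg_projZ e c u : pathalg_proj e (c *: u) = c *: pathalg_proj e u.
Proof. exact: pathalg_extZ. Qed.

Lemma pathalg_proj0 e : pathalg_proj e 0 = 0.
Proof. exact: pathalg_ext0. Qed.

Lemma pcoef_proj e u p :
  pcoef p (pathalg_proj e u) = if pdeg p == e then pcoef p u else 0.
Proof.
elim/pathalg_ind: u => [|u v IH IH'|c u IH|q].
- by rewrite pathalg_proj0 !pcoef0 if_same.
- by rewrite pathalg_projD !pcoefD IH IH'; case: ifP => // _; rewrite addr0.
- by rewrite pathalg_projZ !pcoefZ IH; case: ifP => // _; rewrite mulr0.
rewrite /pathalg_proj {1}pbasisE malg_extU !pcoefU.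
have [->|ne] := eqVneq q p; first by case: ifP; rewrite ?pcoefU ?eqxx ?pcoef0.
by rewrite if_same; case: ifP; rewrite ?pcoefU ?(negPf ne) ?pcoef0.
Qed.

Lemma pathalg_proj_piece e u : pathalg_piece e (pathalg_proj e u).
Proof. by apply/pathalg_pieceP => p pe; rewrite pcoef_proj (negPf pe). Qed.

Lemma pathalg_proj_id e u : pathalg_piece e u -> pathalg_proj e u = u.
Proof.
move=> /pathalg_pieceP h; apply: pathalgP => p; rewrite pcoef_proj.
by case: eqP => // /eqP pe; rewrite h.
Qed.

Lemma pathalg_proj_eq0 e f u :
  pathalg_piece f u -> f != e -> pathalg_proj e u = 0.
Proof.
move=> /pathalg_pieceP h fe; apply: pathalgP => p; rewrite pcoef_proj pcoef0.
by case: eqP => // pe; apply: h; rewrite pe eq_sym.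
Qed.

Lemma pathalg_proj_sum u :
  u = \sum_(e <- undup [seq pdeg p | p <- msupp u]) pathalg_proj e u.
Proof.
apply: pathalgP => p; rewrite pcoef_sum.
under eq_bigr do rewrite pcoef_proj.
have [pu|pNu] := boolP (p \in msupp u); last first.
  have u0 : pcoef p u = 0 by exact: mcoeff_outdom.
  by rewrite big1 // => e _; rewrite u0 if_same.
rewrite (bigD1_seq (pdeg p)) ?undup_uniq ?mem_undup ?map_f //= eqxx.
by rewrite big1 ?addr0 // => e; rewrite eq_sym => /negPf ->.
Qed.

End PathAlgebra.

Section QuotientAlgebra.
Variables (k : fieldType) (B : pzAlgType k) (R : B -> Prop).

Inductive ideal_gen : B -> Prop :=
| ideal_gen0 : ideal_gen 0
| ideal_genD x y : ideal_gen x -> ideal_gen y -> ideal_gen (x + y)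
| ideal_genM a r b : R r -> ideal_gen (a * r * b).

Lemma ideal_genMl a x : ideal_gen x -> ideal_gen (a * x).
Proof.
elim=> [|y z _ IH _ IH'|b r c Rr]; first by rewrite mulr0; constructor.
  by rewrite mulrDr; constructor.
by rewrite mulrA mulrA; constructor.
Qed.

Lemma ideal_genMr a x : ideal_gen x -> ideal_gen (x * a).
Proof.
elim=> [|y z _ IH _ IH'|b r c Rr]; first by rewrite mul0r; constructor.
  by rewrite mulrDl; constructor.
by rewrite -mulrA; constructor.
Qed.

Lemma ideal_genZ (c : k) x : ideal_gen x -> ideal_gen (c *: x).
Proof.
have -> : c *: x = (c *: (1 : B)) * x by rewrite pzscalerAl mul1r.
exact: ideal_genMl.
Qed.

Lemma ideal_genN x : ideal_gen x -> ideal_gen (- x).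
Proof. by rewrite -scaleN1r; exact: ideal_genZ. Qed.

Definition ideal_pred : {pred B} := fun x => `[< ideal_gen x >].

Lemma ideal_predP x : reflect (ideal_gen x) (x \in ideal_pred).
Proof. exact: asboolP. Qed.

Lemma ideal_pred_zmod_closed : zmod_closed ideal_pred.
Proof.
split=> [|x y /ideal_predP hx /ideal_predP hy]; apply/ideal_predP.
  by constructor.
by constructor=> //; exact: ideal_genN.
Qed.

HB.instance Definition _ :=
  GRing.isZmodClosed.Build B ideal_pred ideal_pred_zmod_closed.

Definition quotalg : Type := Quotient.quot ideal_pred.

HB.instance Definition _ := EqQuotient.on quotalg.
HB.instance Definition _ := GRing.Zmodule.on quotalg.
HB.instance Definition _ := ZmodQuotient.on quotalg.

Definition qpi (x : B) : quotalg := \pi_quotalg x.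

Lemma qpi_eq x y : qpi x = qpi y <-> ideal_gen (x - y).
Proof.
split=> [/eqP|h]; last apply/eqP; rewrite /qpi -Quotient.idealrBE; last exact/ideal_predP.
by move/ideal_predP.
Qed.

Lemma qpi_surj (x : quotalg) : exists u, x = qpi u.
Proof. by exists (repr x); rewrite /qpi reprK. Qed.

Lemma qpiD x y : qpi (x + y) = qpi x + qpi y.
Proof. exact: pi_addr. Qed.

Lemma qpi0 : qpi 0 = 0.
Proof. exact: pi_zeror. Qed.

Definition quotalg_scale (c : k) (x : quotalg) : quotalg := qpi (c *: repr x).
Definition quotalg_mul (x y : quotalg) : quotalg := qpi (repr x * repr y).

Lemma repr_qpi x : ideal_gen (repr (qpi x) - x).
Proof. by apply/qpi_eq; rewrite /qpi reprK. Qed.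

Lemma qpiZ c x : quotalg_scale c (qpi x) = qpi (c *: x).
Proof. by apply/qpi_eq; rewrite -scalerBr; apply/ideal_genZ/repr_qpi. Qed.

Lemma qpiM x y : quotalg_mul (qpi x) (qpi y) = qpi (x * y).
Proof.
apply/qpi_eq; set x' := repr _; set y' := repr _.
have -> : x' * y' - x * y = (x' - x) * y' + x * (y' - y).
  by rewrite mulrBl mulrBr addrA subrK.
by constructor; [apply: ideal_genMr | apply: ideal_genMl]; exact: repr_qpi.
Qed.

Fact quotalg_scaleA a b x :
  quotalg_scale a (quotalg_scale b x) = quotalg_scale (a * b) x.
Proof. by have [u ->] := qpi_surj x; rewrite !qpiZ scalerA. Qed.

Fact quotalg_scale1 : left_id 1 quotalg_scale.
Proof. by move=> x; have [u ->] := qpi_surj x; rewrite qpiZ scale1r. Qed.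

Fact quotalg_scaleDr : right_distributive quotalg_scale +%R.
Proof.
move=> a x y; have [u ->] := qpi_surj x; have [v ->] := qpi_surj y.
by rewrite -qpiD !qpiZ -qpiD scalerDr.
Qed.

Fact quotalg_scaleDl x : {morph quotalg_scale^~ x : a b / a + b}.
Proof.
by move=> a b; have [u ->] := qpi_surj x; rewrite !qpiZ -qpiD scalerDl.
Qed.

HB.instance Definition _ := GRing.Zmodule_isLmodule.Build k quotalg
  quotalg_scaleA quotalg_scale1 quotalg_scaleDr quotalg_scaleDl.

Fact quotalg_mulA : associative quotalg_mul.
Proof.
move=> x y z; have [u ->] := qpi_surj x; have [v ->] := qpi_surj y.
by have [w ->] := qpi_surj z; rewrite !qpiM mulrA.
Qed.

Fact quotalg_mul1l : left_id (qpi 1) quotalg_mul.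
Proof. by move=> x; have [u ->] := qpi_surj x; rewrite qpiM mul1r. Qed.

Fact quotalg_mul1r : right_id (qpi 1) quotalg_mul.
Proof. by move=> x; have [u ->] := qpi_surj x; rewrite qpiM mulr1. Qed.

Fact quotalg_mulDl : left_distributive quotalg_mul +%R.
Proof.
move=> x y z; have [u ->] := qpi_surj x; have [v ->] := qpi_surj y.
by have [w ->] := qpi_surj z; rewrite -qpiD !qpiM -qpiD mulrDl.
Qed.

Fact quotalg_mulDr : right_distributive quotalg_mul +%R.
Proof.
move=> x y z; have [u ->] := qpi_surj x; have [v ->] := qpi_surj y.
by have [w ->] := qpi_surj z; rewrite -qpiD !qpiM -qpiD mulrDr.
Qed.

Fact quotalg_mulZl (c : k) (x y : quotalg) :
  quotalg_mul (c *: x) y = c *: quotalg_mul x y.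
Proof.
have [u ->] := qpi_surj x; have [v ->] := qpi_surj y.
by rewrite /GRing.scale /= qpiZ !qpiM qpiZ pzscalerAl.
Qed.

Fact quotalg_mulZr (c : k) (x y : quotalg) :
  quotalg_mul x (c *: y) = c *: quotalg_mul x y.
Proof.
have [u ->] := qpi_surj x; have [v ->] := qpi_surj y.
by rewrite /GRing.scale /= qpiZ !qpiM qpiZ pzscalerAr.
Qed.

HB.instance Definition _ := GRing.Zmodule_isPzRing.Build quotalg
  quotalg_mulA quotalg_mul1l quotalg_mul1r quotalg_mulDl quotalg_mulDr.
HB.instance Definition _ := Lmodule_isPzAlg.Build k quotalg
  quotalg_mulA quotalg_mul1l quotalg_mul1r quotalg_mulDl quotalg_mulDr
  quotalg_mulZl quotalg_mulZr.

End QuotientAlgebra.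

Section QuotientGrading.
Variables (k : fieldType) (Q : quiver) (R : pathalg Q k -> Prop).
Hypothesis homR : forall r, R r -> exists e, pathalg_piece e r.

Definition quot_piece (e : int) (x : quotalg R) : Prop :=
  exists2 u, pathalg_piece e u & x = qpi R u.

Lemma ideal_gen_proj e u : ideal_gen R u -> ideal_gen R (pathalg_proj e u).
Proof.
elim=> [|x y _ IH _ IH'|a r b Rr]; first by rewrite pathalg_proj0; constructor.
  by rewrite pathalg_projD; constructor.
have [f hr] := homR Rr.
elim/pathalg_ind: a => [|a a' IH IH'|c a IH|p].
- by rewrite !mul0r pathalg_proj0; constructor.
- by rewrite !mulrDl pathalg_projD; constructor.
- have -> : c *: a * r * b = c *: (a * r * b).
    by rewrite [c *: a * r]pzscalerAl [_ * b]pzscalerAl.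
  by rewrite pathalg_projZ; exact: ideal_genZ.
elim/pathalg_ind: b => [|b b' IH IH'|c b IH|q].
- by rewrite !mulr0 pathalg_proj0; constructor.
- by rewrite !mulrDr pathalg_projD; constructor.
- have -> : pbasis k p * r * (c *: b) = c *: (pbasis k p * r * b).
    by rewrite [_ * (c *: b)]pzscalerAr.
  by rewrite pathalg_projZ; exact: ideal_genZ.
have h := pathalg_pieceM (pathalg_pieceM (@pathalg_pieceU Q k p) hr) (@pathalg_pieceU Q k q).
have [<-|ne] := eqVneq (pdeg p + f + pdeg q) e.
  by rewrite pathalg_proj_id //; constructor.
by rewrite (pathalg_proj_eq0 h ne); constructor.
Qed.

Fact quot_piece0 e : quot_piece e 0.
Proof. by exists 0; [exact: pathalg_piece0 | rewrite qpi0]. Qed.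

Fact quot_pieceD e x y :
  quot_piece e x -> quot_piece e y -> quot_piece e (x + y).
Proof.
move=> [u hu ->] [v hv ->]; exists (u + v); first exact: pathalg_pieceD.
by rewrite qpiD.
Qed.

Fact quot_pieceZ e (c : k) x : quot_piece e x -> quot_piece e (c *: x).
Proof.
move=> [u hu ->]; exists (c *: u); first exact: pathalg_pieceZ.
exact: qpiZ.
Qed.

Fact quot_piece1 : quot_piece 0 1.
Proof. by exists 1; first exact: pathalg_piece1. Qed.

Fact quot_pieceM e f x y :
  quot_piece e x -> quot_piece f y -> quot_piece (e + f) (x * y).
Proof.
move=> [u hu ->] [v hv ->]; exists (u * v); first exact: pathalg_pieceM.
exact: qpiM.
Qed.

Lemma qpi_sum (I : Type) (s : seq I) (F : I -> pathalg Q k) :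
  qpi R (\sum_(i <- s) F i) = \sum_(i <- s) qpi R (F i).
Proof. exact: (big_morph (qpi R) (qpiD R) (qpi0 R)). Qed.

Fact quot_piece_sum x : exists (s : seq int) (c : int -> quotalg R),
  (forall e, quot_piece e (c e)) /\ x = \sum_(e <- s) c e.
Proof.
have [u ->] := qpi_surj x.
exists (undup [seq pdeg p | p <- msupp u]), (fun e => qpi R (pathalg_proj e u)).
split=> [e|]; first by exists (pathalg_proj e u) => //; exact: pathalg_proj_piece.
by rewrite -qpi_sum -pathalg_proj_sum.
Qed.

Fact quot_piece_direct (s : seq int) (c : int -> quotalg R) : uniq s ->
  (forall e, quot_piece e (c e)) -> \sum_(e <- s) c e = 0 ->
  forall e, e \in s -> c e = 0.
Proof.
move=> us hc; have /choice [u hu] : forall e, exists u : pathalg Q k,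
    pathalg_piece e u /\ c e = qpi R u.
  by move=> e; have [u] := hc e; exists u.
rewrite (eq_bigr (fun e => qpi R (u e))) => [|e _]; last by have [] := hu e.
rewrite -qpi_sum -qpi0 => /qpi_eq; rewrite subr0 => h e es.
have [_ ->] := hu e; apply/qpi_eq; rewrite subr0.
have := ideal_gen_proj e h; rewrite (big_morph (pathalg_proj e)
  (pathalg_projD e) (pathalg_proj0 _ _ e)) (bigD1_seq e) //=.
rewrite big1 => [|f fe]; last by apply: pathalg_proj_eq0 fe; have [] := hu f.
by rewrite addr0 pathalg_proj_id //; have [] := hu e.
Qed.

Definition quot_grading : grading (quotalg R) :=
  Grading quot_piece0 quot_pieceD quot_pieceZ quot_piece1 quot_pieceM
    quot_piece_sum quot_piece_direct.

End QuotientGrading.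

(* Every edge consists of exactly two halfedges; both may be at the same vertex.
   The orbits of [hnext] are the sets of halfedges at the vertices, so that
   [hnext] is a cyclic order on each of them; [hdeg i] is d(i, i+1). *)
Record sgraph := SGraph {
  vertex : finType;
  edge : finType;
  half : finType;
  vert_of : half -> vertex;
  edge_of : half -> edge;
  edge_of_card : forall e, #|[set i | edge_of i == e]| = 2%N;
  hnext : {perm half};
  hnext_orbit : forall i j, (j \in porbit hnext i) = (vert_of j == vert_of i);
  hdeg : half -> int;
  hdeg_gt0 : forall i, 0 < hdeg i
}.

Definition vdeg (S : sgraph) (v : vertex S) : int :=
  \sum_(i | vert_of i == v) hdeg i.

Definition compatible (S : sgraph) (n : int) : Prop :=
  forall v : vertex S, exists2 m : int, 0 < m & n = m * vdeg v.

(* An orientation of the edges is given by the halfedges pointing towards their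
   vertex: exactly one of the two halfedges of each edge. *)
Definition orientable (S : sgraph) : Prop :=
  exists toward : half S -> bool,
    [/\ forall i j, i != j -> edge_of i = edge_of j -> toward j = ~~ toward i,
        forall i, hnext S i != i ->
          (2 %| hdeg i)%Z = (toward i == toward (hnext S i))
      & forall i, hnext S i = i -> (2 %| vdeg (vert_of i))%Z].

Section BrauerAlgebra.
Variables (k : fieldType) (S : sgraph) (n : int).

Definition sgraph_quiver : quiver :=
  @Quiver (edge S) (half S) (@edge_of S) (fun i => edge_of (hnext S i))
    (@hdeg S).

Local Notation a_ i := (arrow k (i : qarr sgraph_quiver)).

(* a_(i-1) ... a_(i+1) a_i, once around the vertex of i. *)
Definition turn (i : half S) : pathalg sgraph_quiver k :=
  \prod_(j <- rev (traject (hnext S) i #|porbit (hnext S) i|)) a_ j.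

(* The division is exact when n is compatible with S. *)
Definition cyc (i : half S) : pathalg sgraph_quiver k :=
  turn i ^+ `|(n %/ vdeg (vert_of i))%Z|.

Inductive brauer_rel : pathalg sgraph_quiver k -> Prop :=
| brauer_rel0 i j of hnext S i != j & edge_of (hnext S i) = edge_of j :
    brauer_rel (a_ j * a_ i)
| brauer_rel_cyc i j of i != j & edge_of i = edge_of j :
    brauer_rel (cyc i - (-1) ^ (n - 1) *: cyc j).

Definition brauer : Type := quotalg brauer_rel.
HB.instance Definition _ := PzAlg.on brauer.

Hypothesis hn : compatible S n.

Lemma arrow_piece i : pathalg_piece (hdeg i) (a_ i).
Proof.
have <- : pdeg (parr (i : qarr sgraph_quiver)) = hdeg i.
  by rewrite /pdeg big_seq1.
exact: pathalg_pieceU.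
Qed.

Lemma turn_piece i : pathalg_piece (vdeg (vert_of i)) (turn i).
Proof.
have -> : vdeg (vert_of i) =
    \sum_(j <- rev (traject (hnext S) i #|porbit (hnext S) i|)) hdeg j.
  rewrite /vdeg -big_filter; apply: perm_big; rewrite perm_sym perm_rev perm_sym.
  apply: uniq_perm; rewrite ?filter_uniq ?index_enum_uniq ?uniq_traject_porbit //.
  by move=> j; rewrite mem_filter mem_index_enum andbT -hnext_orbit porbit_traject.
rewrite /turn; elim: (rev _) => [|j s IH]; rewrite ?big_nil ?big_cons.
  exact: pathalg_piece1.
by apply: pathalg_pieceM IH; exact: arrow_piece.
Qed.

Lemma cyc_piece i : pathalg_piece n (cyc i).
Proof.
have [m m0 nE] := hn (vert_of i).
have v0 : 0 < vdeg (vert_of i).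
  rewrite /vdeg (bigD1 i) //=; apply: ltr_wpDr; last exact: hdeg_gt0.
  by apply: sumr_ge0 => j _; exact/ltW/hdeg_gt0.
rewrite /cyc {2}nE mulzK ?gt_eqF //; rewrite nE -{1}(gez0_abs (ltW m0)).
elim: `|m|%N => [|q IH]; first by rewrite mul0r expr0; exact: pathalg_piece1.
rewrite exprS -addn1 PoszD mulrDl mul1r addrC.
by apply: pathalg_pieceM IH; exact: turn_piece.
Qed.

Lemma brauer_rel_homogeneous r : brauer_rel r -> exists e, pathalg_piece e r.
Proof.
case=> [i j _ _|i j _ _].
  by exists (hdeg j + hdeg i); apply: pathalg_pieceM; exact: arrow_piece.
exists n; apply: pathalg_pieceD; first exact: cyc_piece.
by rewrite -scaleNr; apply: pathalg_pieceZ; exact: cyc_piece.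
Qed.

Definition brauer_grading : grading brauer :=
  quot_grading brauer_rel_homogeneous.

End BrauerAlgebra.

(* Main.v *)
Require Import Defs.
From mathcomp Require Import all_boot all_order all_algebra.
From HB Require Import structures.
From mathcomp Require Import all_fingroup generic_quotient.
From mathcomp Require Import zify ring.
Import Defs.

(** Call rotation a path that repeatedly passes from a halfedge to the next one
at the same vertex, and let c_i be the rotation from i of length L_i going
n/m times around the vertex.  A path that is not a rotation contains a product
a_j a_i with i+1 <> j, hence vanishes in the algebra.  So does a rotation from i
that is longer than L_i: it contains a_i c_i = +- a_i c_j, where j is the other
half of the edge, and a_i c_j contains a product a_i a_(j-1) = 0.  Thus the
algebra is spanned by the idempotents of the edges, the rotations of length
strictly between 0 and L_i, and one cycle c_i per edge
([path_class_basis]).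

The trace reads off the coefficients of the cycles c_i, weighted by signs t_i:
tr(c_i) = t_i, and tr vanishes on every other path.  For this functional on the
path algebra to kill the relations one needs t_j = (-1)^(n-1) t_i for the two
halves of an edge.  Moving the first arrow a_i of c_i, of degree d = d(i,i+1), past the
other arrows, of total degree n - d, gives c_(i+1), so graded symmetry needs
t_(i+1) = (-1)^(d(n-d)) t_i = (-1)^((n-1)d) t_i.  Such signs are called a
[twist].  If n is odd, all t_i = 1 will do.  If n is even, an orientation
of the edges provides them: t_i = -1 when i points towards its vertex, and 1
otherwise ([twist_exists]); at a 1-valent vertex the condition on t says that
(n-1)d is even, which is why its degree d has to be even.

For non-degeneracy, each spanning path b has a complement b' such that b b' is
some cycle c_x, and tr(b b'') = 0 for the complement b'' of any other spanning
path ([dual_path_comp], [dual_path_inj]).  Up to the signs t_x these are dual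
bases, and x = sum_b tr(x b') b follows for all x of the algebra.  This
proves at once that the spanning set is finite and that tr(x y) = 0 for all y
forces x = 0; symmetry of the trace handles the other side. *)

Set Implicit Arguments.
Unset Strict Implicit.
Unset Printing Implicit Defensive.

Import Order.TTheory GRing.Theory Num.Theory.
Local Open Scope ring_scope.

(** * Dual bases *)

Section DualBases.
Variables (k : fieldType) (A : pzAlgType k) (tr : {scalar A}).
Variables (I : finType) (b d : I -> A).
Hypothesis dual : forall x, x = \sum_y tr (x * d y) *: b y.

(** The list of the pairs (b y, d y) serves here to index the vectors and their
coefficients by the same natural numbers, even when [I] is empty. *)
Lemma dual_finite_dim : finite_dim A.
Proof.
pose D := [seq (b y, d y) | y <- index_enum I].
exists (unzip1 D) => x; exists (fun i => tr (x * (unzip2 D)`_i)).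
rewrite {1}[x]dual; transitivity (\sum_(p <- D) tr (x * p.2) *: p.1).
  by rewrite big_map.
pose F i := tr (x * (unzip2 D)`_i) *: (unzip1 D)`_i.
rewrite (big_nth (0, 0)) -(big_mkord xpredT F) [size (unzip1 D)]size_map.
rewrite big_nat [RHS]big_nat; apply: eq_bigr => i /andP[_ iD].
by rewrite /F !(nth_map (0, 0)).
Qed.

Lemma dual_nondegenerate x : (forall y, tr (x * y) = 0) -> x = 0.
Proof.
by move=> h; rewrite [x]dual big1 // => y _; rewrite h scale0r.
Qed.

End DualBases.

(** * Signs *)

Section Sign.
Variable k : fieldType.

Lemma sign_eq_mod2 (e f : int) : (2 %| e - f)%Z -> (-1) ^ e = (-1) ^ f :> k.
Proof.
move=> /dvdzP[g efE]; have -> : e = f + 2 * g by rewrite mulrC -efE; lia.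
by rewrite expfzDr ?oppr_eq0 ?oner_eq0 // -exprz_exp -exprnP sqrrN expr1n exp1rz mulr1.
Qed.

Lemma sign_even (e : int) : (2 %| e)%Z -> (-1) ^ e = 1 :> k.
Proof. by move=> e2; rewrite (@sign_eq_mod2 e 0) ?subr0. Qed.

Lemma sign_odd (e : int) : ~~ (2 %| e)%Z -> (-1) ^ e = -1 :> k.
Proof. by move=> e2; rewrite (@sign_eq_mod2 e 1) //; lia. Qed.

Lemma signM (e : int) : (-1) ^ e * (-1) ^ e = 1 :> k.
Proof.
rewrite -expfzDr ?oppr_eq0 ?oner_eq0 //; apply: sign_even; lia.
Qed.

End Sign.

Section Twist.
Variables (k : fieldType) (S : sgraph) (n : int).

(** The values of the trace on the cycles c_i.  Since d and d^2 have the same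
parity, the sign (-1)^(d(n-d)) of graded symmetry is (-1)^((n-1)d), which is
multiplicative in d. *)
Record twist (t : half S -> k) := Twist {
  twist_sq : forall i, t i * t i = 1;
  twist_next : forall i, t (hnext S i) = (-1) ^ ((n - 1) * hdeg i) * t i;
  twist_edge : forall i j, i != j -> edge_of i = edge_of j ->
    t j = (-1) ^ (n - 1) * t i
}.

Lemma vdeg_fixed (i : half S) : hnext S i = i -> vdeg (vert_of i) = hdeg i.
Proof.
move=> fi; rewrite /vdeg (big_pred1 i) // => j; rewrite -hnext_orbit.
apply/idP/eqP => [/porbitP[l ->]|->]; last exact: porbit_id.
by rewrite permX iter_fix.
Qed.

(** For even n, the signs required along a_i and across an edge are
(-1)^(d(i,i+1)) and -1: an orientation of the edges provides exactly these. *)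
Lemma twist_exists : ~~ (2 %| n)%Z \/ orientable S -> exists t, twist t.
Proof.
have [n2 [//|[toward [edgeP nextP loopP]]]|n2 _] := boolP (2 %| n)%Z.
  exists (fun i => (-1) ^+ toward i); split=> [i|i|i j ij eij].
  - by rewrite -expr2 sqrr_sign.
  - have [fi|fi] := eqVneq (hnext S i) i.
      rewrite fi sign_even ?mul1r //; have := loopP _ fi.
      by rewrite vdeg_fixed //; lia.
    (* The sign changes along a_i exactly when d(i,i+1) is odd. *)
    have := nextP _ fi; have [d2 /esym/eqP <-|d2 /esym tE] := boolP (2 %| hdeg i)%Z.
      by rewrite sign_even ?mul1r //; lia.
    rewrite -exprz_exp (@sign_odd _ (n - 1)) 1?(@sign_odd _ (hdeg i)) //; last lia.
    by move: tE; case: (toward i); case: (toward _) => //= _; ring.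
  rewrite (edgeP _ _ ij eij) sign_odd; last lia.
  by case: (toward i) => /=; ring.
have s1 : (-1) ^ (n - 1) = 1 :> k by apply: sign_even; lia.
by exists (fun=> 1); split=> *; rewrite -?exprz_exp ?s1 ?exp1rz ?mulr1.
Qed.

End Twist.

(** * Rotations *)

Section PathProducts.
Variables (Q : quiver) (k : fieldType).
Implicit Types p q r : qpath Q.

Lemma pbasisM p q : pbasis k p * pbasis k q = oapp (pbasis k) 0 (pcomp p q).
Proof. exact: pathalg_mulU. Qed.

Lemma pbasisM_some p q r :
  pcomp p q = Some r -> pbasis k p * pbasis k q = pbasis k r.
Proof. by move=> e; rewrite pbasisM e. Qed.

Lemma pcomp_Some p q r : pend q = pstart p -> pstart r = pstart q ->
  parrs r = parrs q ++ parrs p -> pcomp p q = Some r.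
Proof.
move=> e sE aE; case: pcompP => [r' _ s' a' _|]; last by rewrite e eqxx.
by congr Some; apply: qpath_eq; rewrite ?s' ?a'.
Qed.

Lemma parrs_nil p : parrs p = [::] -> p = pnil (pstart p).
Proof. by move=> pE; apply: qpath_eq. Qed.

End PathProducts.

Section Rotations.
Variable S : sgraph.
Local Notation next := (hnext S).
Local Notation Q := (sgraph_quiver S).
Implicit Types (i j x : half S) (p q : qpath Q).

Lemma rotation_subproof i l :
  is_path ((edge_of i, traject next i l) : qvert Q * seq (qarr Q)).
Proof. by rewrite /is_path /=; elim: l i => //= l IH i; rewrite eqxx IH. Qed.

(** The path a_(i+l-1) ... a_(i+1) a_i, turning around the vertex of [i]. *)
Definition rotation i l : qpath Q :=
  exist _ (_ : qvert Q * seq (qarr Q)) (rotation_subproof i l).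

Lemma pdeg_rotation i l :
  pdeg (rotation i l) = \sum_(j <- traject next i l) hdeg j.
Proof. by []. Qed.

Lemma pend_rotation i l : pend (rotation i l) = edge_of (iter l next i).
Proof.
rewrite /pend /walk_end /pstart /parrs /=.
by elim: l i => //= l IH i; rewrite IH -iterSr.
Qed.

Lemma rotation0 i : rotation i 0 = pnil (edge_of i : qvert Q).
Proof. exact: qpath_eq. Qed.

Lemma rotation1 i : rotation i 1 = parr (i : qarr Q).
Proof. exact: qpath_eq. Qed.

Lemma rotation_inj i j l m : (0 < l)%N ->
  rotation i l = rotation j m -> i = j /\ l = m.
Proof.
move=> l0 /(congr1 (@parrs Q)); rewrite /parrs /= => E.
have lm : l = m by have := congr1 size E; rewrite !size_traject.
by split=> //; move: l0 E; rewrite -lm; case: l {lm} => //= l _ [].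
Qed.

Lemma rotation_comp i l m :
  pcomp (rotation (iter l next i) m) (rotation i l) = Some (rotation i (l + m)).
Proof.
by apply: pcomp_Some; rewrite ?pend_rotation // /parrs /= trajectD.
Qed.

(** The factors of a rotation are rotations: this is what makes the trace of a
product of paths computable. *)
Lemma rotation_split p q i m : pcomp p q = Some (rotation i m) ->
  exists2 l, (l <= m)%N &
    q = rotation i l /\ p = rotation (iter l next i) (m - l).
Proof.
case: pcompP => // r qp sE aE eE [rE]; rewrite {}rE in sE aE eE.
have sz : m = (size (parrs q) + size (parrs p))%N.
  by rewrite -size_cat -aE size_traject.
exists (size (parrs q)); first by rewrite sz leq_addr.
move: aE; rewrite {1}/parrs /= sz trajectD addKn => /eqP.
rewrite eqseq_cat ?size_traject // => /andP[/eqP qE /eqP pE].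
have qR : q = rotation i (size (parrs q)) by apply: qpath_eq.
split=> //; apply: qpath_eq => //.
by rewrite -qp {1}qR pend_rotation.
Qed.

End Rotations.

Section Cycles.
Variables (S : sgraph) (n : int).
Hypothesis hn : compatible S n.
Local Notation next := (hnext S).
Local Notation Q := (sgraph_quiver S).
Implicit Types (i j x : half S) (p q : qpath Q).

(** The number L_i of arrows in c_i: n/m turns through all halfedges of a vertex
of degree m. *)
Definition cyc_length i : nat :=
  (`|(n %/ vdeg (vert_of i))%Z| * #|porbit next i|)%N.

Definition cyc_path i : qpath Q := rotation i (cyc_length i).

Lemma vert_of_iter l i : vert_of (iter l next i) = vert_of i.
Proof. by apply/eqP; rewrite -hnext_orbit -permX mem_porbit. Qed.

Lemma porbit_iter l i : porbit next (iter l next i) = porbit next i.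
Proof. by apply/eqP; rewrite eq_porbit_mem hnext_orbit vert_of_iter. Qed.

Lemma cyc_length_iter l i : cyc_length (iter l next i) = cyc_length i.
Proof. by rewrite /cyc_length vert_of_iter porbit_iter. Qed.

Lemma iter_cyc_length i : iter (cyc_length i) next i = i.
Proof. by rewrite iterM iter_fix // iter_porbit. Qed.

Lemma vdeg_gt0 i : 0 < vdeg (vert_of i).
Proof.
rewrite /vdeg (bigD1 i) //=; apply: ltr_wpDr; last exact: hdeg_gt0.
by apply: sumr_ge0 => j _; exact/ltW/hdeg_gt0.
Qed.

Lemma cyc_length_gt0 i : (0 < cyc_length i)%N.
Proof.
have [m m0 nE] := hn (vert_of i).
rewrite muln_gt0 [X in _ && X]lt0n card_porbit_neq0 andbT nE mulzK ?gt_eqF ?vdeg_gt0 //.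
by rewrite absz_gt0 gt_eqF.
Qed.

Lemma cyc_path_inj : injective cyc_path.
Proof. by move=> i j /(rotation_inj (cyc_length_gt0 i))[]. Qed.

Section CycleProduct.
Variable k : fieldType.

Lemma rotation_mul i l m :
  pbasis k (rotation (iter l next i) m) * pbasis k (rotation i l) =
  pbasis k (rotation i (l + m)).
Proof. exact/pbasisM_some/rotation_comp. Qed.

Lemma prod_arrow_rotation i l :
  \prod_(j <- rev (traject next i l.+1)) arrow k (j : qarr Q) =
  pbasis k (rotation i l.+1).
Proof.
elim: l i => [|l IH] i.
  by rewrite /= big_seq1 rotation1.
rewrite trajectS rev_cons big_rcons /= IH.
by rewrite /arrow -rotation1 (rotation_mul i 1).
Qed.

Lemma turnE i : turn k i = pbasis k (rotation i #|porbit next i|).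
Proof.
rewrite /turn; case E: #|_| => [|l]; last exact: prod_arrow_rotation.
by have := card_porbit_neq0 next i; rewrite E.
Qed.

Lemma cycE i : cyc k n i = pbasis k (cyc_path i).
Proof.
rewrite /cyc /cyc_path turnE /cyc_length.
have := cyc_length_gt0 i; rewrite muln_gt0 => /andP[].
set N := #|_|; case: `|_|%N => // m _ _.
have Ni : iter N next i = i by exact: iter_porbit.
elim: m => [|m IH]; first by rewrite expr1 mul1n.
by rewrite exprSr IH -{1}Ni rotation_mul mulSn.
Qed.

End CycleProduct.

(** The degree of a path does not involve the field, so that any field can be
used to obtain it from the homogeneity of c_i. *)
Lemma cyc_path_deg i : pdeg (cyc_path i) = n.
Proof.
have := @cyc_piece rat S n hn i; rewrite (cycE rat); apply.
by rewrite pcoefU eqxx oner_eq0.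
Qed.

End Cycles.

(** * The trace *)

Section Trace.
Variables (k : fieldType) (S : sgraph) (n : int).
Hypothesis hn : compatible S n.
Variable t : half S -> k.
Hypothesis tw : twist n t.
Local Notation next := (hnext S).
Local Notation Q := (sgraph_quiver S).
Local Notation cyc_path := (cyc_path n).
Local Notation cyc_length := (cyc_length n).
Implicit Types (i j x : half S) (p q : qpath Q) (u v : pathalg Q k).

(** The functional on the path algebra, before passing to the quotient. *)
Definition path_trace u : k := \sum_i t i * pcoef (cyc_path i) u.

Lemma path_trace0 : path_trace 0 = 0.
Proof. by apply: big1 => i _; rewrite pcoef0 mulr0. Qed.

Lemma path_traceD u v : path_trace (u + v) = path_trace u + path_trace v.
Proof.
by rewrite -big_split; apply: eq_bigr => i _ /=; rewrite pcoefD mulrDr.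
Qed.

Lemma path_traceZ c u : path_trace (c *: u) = c * path_trace u.
Proof.
by rewrite mulr_sumr; apply: eq_bigr => i _; rewrite pcoefZ mulrCA.
Qed.

Lemma path_trace_cyc i : path_trace (pbasis k (cyc_path i)) = t i.
Proof.
rewrite /path_trace (bigD1 i) //= pcoefU eqxx mulr1 big1 ?addr0 // => j ji.
by rewrite pcoefU (inj_eq (cyc_path_inj hn)) eq_sym (negPf ji) mulr0.
Qed.

Lemma path_trace_neq0 p : path_trace (pbasis k p) != 0 -> exists i, p = cyc_path i.
Proof.
move=> nz; have [/existsP[i /eqP pE]|/existsPn pN] :=
  boolP [exists i, p == cyc_path i]; first by exists i.
by case/eqP: nz; apply: big1 => i _; rewrite pcoefU (negPf (pN i)) mulr0.
Qed.

Lemma path_trace_mul_neq0 p q : path_trace (pbasis k p * pbasis k q) != 0 ->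
  exists i, pcomp p q = Some (cyc_path i).
Proof.
rewrite pbasisM; case: (pcomp p q) => [r|] /=; last by rewrite path_trace0 eqxx.
by move=> /path_trace_neq0[i ->]; exists i.
Qed.

Lemma path_trace_piece e u : e != n -> pathalg_piece e u -> path_trace u = 0.
Proof.
move=> en /pathalg_pieceP hu; apply: big1 => i _.
by rewrite hu ?mulr0 // cyc_path_deg // eq_sym.
Qed.

Lemma twist_iter l i :
  t (iter l next i) = (-1) ^ ((n - 1) * pdeg (rotation i l)) * t i.
Proof.
elim: l => [|l IH]; first by rewrite /pdeg big_nil mulr0 expr0z mul1r.
rewrite iterS (twist_next tw) IH mulrA -expfzDr ?oppr_eq0 ?oner_eq0 //.
rewrite -mulrDr; congr ((-1) ^ (_ * _) * _).
by rewrite !pdeg_rotation trajectSr -cats1 big_cat big_seq1 addrC.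
Qed.

(** If p q = c_i, then q p is the cycle c_x, where [x] is reached from [i] along
q; the twist accumulates the sign on the way. *)
Lemma path_trace_rotate p q i : pcomp p q = Some (cyc_path i) ->
  path_trace (pbasis k p * pbasis k q) =
  (-1) ^ ((n - 1) * pdeg q) * path_trace (pbasis k q * pbasis k p).
Proof.
move=> pq; rewrite (pbasisM_some _ pq) path_trace_cyc.
have [l lL [qE pE]] := rotation_split pq; set x := iter l next i in pE.
have Lx : (cyc_length i - l + l)%N = cyc_length x.
  by rewrite subnK // cyc_length_iter.
have iE : i = iter (cyc_length i - l) next x by rewrite -iterD subnK // iter_cyc_length.
have -> : pbasis k q * pbasis k p = pbasis k (cyc_path x).
  by rewrite qE pE [in rotation i l]iE rotation_mul Lx.
by rewrite path_trace_cyc twist_iter -qE mulrA signM mul1r.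
Qed.

Lemma path_traceC_path p q :
  path_trace (pbasis k p * pbasis k q) =
  (-1) ^ ((n - 1) * pdeg q) * path_trace (pbasis k q * pbasis k p).
Proof.
have [pq0|/path_trace_mul_neq0[i]] :=
  eqVneq (path_trace (pbasis k p * pbasis k q)) 0; last exact: path_trace_rotate.
have [->|/path_trace_mul_neq0[i qp]] :=
  eqVneq (path_trace (pbasis k q * pbasis k p)) 0; first by rewrite pq0 mulr0.
by rewrite (path_trace_rotate qp) pq0 !mulr0.
Qed.

(** The sign involves the degree of [q] only, so that [u] may be an arbitrary
element: this transfers non-degeneracy from one side to the other. *)
Lemma path_traceC u q :
  path_trace (u * pbasis k q) =
  (-1) ^ ((n - 1) * pdeg q) * path_trace (pbasis k q * u).
Proof.
elim/pathalg_ind: u => [|u v IH IH'|c u IH|p]; last exact: path_traceC_path.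
- by rewrite mul0r mulr0 path_trace0 mulr0.
- by rewrite mulrDl mulrDr !path_traceD IH IH' mulrDr.
- by rewrite pzscalerAl pzscalerAr !path_traceZ IH mulrCA.
Qed.

(** Homogeneous elements are the values of the projection, which is linear and
maps a path to itself or to 0; thus it is enough to treat paths. *)
Lemma path_traceC_proj e u v :
  path_trace (u * pathalg_proj e v) =
  (-1) ^ ((n - 1) * e) * path_trace (pathalg_proj e v * u).
Proof.
elim/pathalg_ind: v => [|v w IH IH'|c v IH|p].
- by rewrite pathalg_proj0 mul0r mulr0 path_trace0 mulr0.
- by rewrite pathalg_projD (mulrDr u) (mulrDl _ _ u) !path_traceD IH IH' mulrDr.
- by rewrite pathalg_projZ pzscalerAl pzscalerAr !path_traceZ IH mulrCA.
have pU := @pathalg_pieceU Q k p; have [<-|ne] := eqVneq (pdeg p) e.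
  by rewrite pathalg_proj_id // path_traceC.
by rewrite (pathalg_proj_eq0 pU ne) mul0r mulr0 path_trace0 mulr0.
Qed.

(** Both sides vanish unless d + e = n, and then d e and (n - 1) e have the same
parity. *)
Lemma path_traceC_homog d e u v : pathalg_piece d u -> pathalg_piece e v ->
  path_trace (u * v) = (-1) ^ (d * e) * path_trace (v * u).
Proof.
move=> hu hv; have [den|den] := eqVneq (d + e) n; last first.
  rewrite (path_trace_piece den (pathalg_pieceM hu hv)).
  rewrite addrC in den.
  by rewrite (path_trace_piece den (pathalg_pieceM hv hu)) mulr0.
rewrite -(pathalg_proj_id hv) path_traceC_proj; congr (_ * _).
apply: sign_eq_mod2; rewrite -den.
(* A product of two successive integers is even. *)
have -> : (d + e - 1) * e - d * e = e * (e - 1) by ring.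
have [e2|e2] := boolP (2 %| e)%Z; first exact: dvdz_mulr.
by apply: dvdz_mull; lia.
Qed.

Lemma path_trace_mul3_neq0 p q r :
    path_trace (pbasis k p * pbasis k q * pbasis k r) != 0 ->
  exists i l m m', [/\ r = rotation i l, q = rotation (iter l next i) m,
    p = rotation (iter (l + m) next i) m' & (l + m + m')%N = cyc_length i].
Proof.
rewrite [pbasis k p * _]pbasisM; case pq : pcomp => [s|] /=; last first.
  by rewrite mul0r path_trace0 eqxx.
move=> /path_trace_mul_neq0[i /rotation_split[l lL [-> sE]]].
rewrite sE in pq; have [m mL [-> ->]] := rotation_split pq.
exists i, l, m, (cyc_length i - l - m)%N; split=> //; last lia.
by rewrite -iterD addnC.
Qed.

(** A rotation of length L_i around the vertex of [i] that contains c_i is c_i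
itself, so that the other two factors are trivial paths. *)
Lemma path_trace_mul_cyc p q i :
  path_trace (pbasis k p * pbasis k (cyc_path i) * pbasis k q) =
  if (p == pnil (edge_of i : qvert Q)) && (q == pnil (edge_of i : qvert Q))
  then t i else 0.
Proof.
case: ifP => [/andP[/eqP-> /eqP->]|ne].
  rewrite -rotation0 -{1}(iter_cyc_length n i) !rotation_mul addn0.
  by rewrite (rotation_mul k i 0) path_trace_cyc.
apply/eqP; apply: contraFT ne => /path_trace_mul3_neq0[j [l [m [m' [qE cE pE]]]]].
have [iE mE] := rotation_inj (cyc_length_gt0 hn i) cE.
rewrite -mE iE cyc_length_iter => L.
have [l0 m0] : l = 0%N /\ m' = 0%N by lia.
move: iE; rewrite qE pE l0 m0 -mE /= => ->.
by rewrite iter_cyc_length !rotation0 !eqxx.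
Qed.

Lemma path_trace_mul_broken p q i j : next i != j ->
  path_trace (pbasis k p * (arrow k (j : qarr Q) * arrow k (i : qarr Q)) *
    pbasis k q) = 0.
Proof.
move=> ij; apply/eqP; apply: contraNT ij.
rewrite [arrow _ _ * _]pbasisM; case: pcompP => [s _ _ aE _|_] /=; last first.
  by rewrite mulr0 mul0r path_trace0 eqxx.
move=> /path_trace_mul3_neq0[x [l [m [m' [_ sE _ _]]]]].
move: aE; rewrite sE /parrs /=; set y := iter _ _ _.
by case: m {sE} => [|[|[|m]]] //= [-> ->].
Qed.

(** The two cycles of a relation are loops at the same edge, so the same p and q
make their multiples p c_i q and p c_j q have a non-zero trace; the values t_i
and t_j then cancel by the edge condition of the twist. *)
Lemma path_trace_rel p q r : brauer_rel n r ->
  path_trace (pbasis k p * r * pbasis k q) = 0.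
Proof.
case=> [i j ij _|i j ij eij]; first exact: path_trace_mul_broken.
rewrite !(cycE hn) -scaleNr mulrDr mulrDl pzscalerAr pzscalerAl path_traceD.
rewrite path_traceZ !path_trace_mul_cyc -eij.
case: ifP; rewrite ?mulr0 ?addr0 // => _.
by rewrite (twist_edge tw ij eij) mulNr mulrA signM mul1r subrr.
Qed.

Lemma path_trace_ideal u : ideal_gen (@brauer_rel k S n) u -> path_trace u = 0.
Proof.
elim=> [|v w _ IH _ IH'|a r b Rr]; first exact: path_trace0.
  by rewrite path_traceD IH IH' addr0.
elim/pathalg_ind: a => [|a a' IH IH'|c a IH|p].
- by rewrite !mul0r path_trace0.
- by rewrite !mulrDl path_traceD IH IH' addr0.
- by rewrite 2!pzscalerAl path_traceZ IH mulr0.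
elim/pathalg_ind: b => [|b b' IH IH'|c b IH|q]; last exact: path_trace_rel.
- by rewrite mulr0 path_trace0.
- by rewrite mulrDr path_traceD IH IH' addr0.
- by rewrite pzscalerAr path_traceZ IH mulr0.
Qed.

(** The choice of the representative does not matter, by [path_trace_ideal]. *)
Definition brauer_trace (x : brauer k S n) : k := path_trace (repr x).

Lemma brauer_traceE u :
  brauer_trace (qpi (@brauer_rel k S n) u) = path_trace u.
Proof.
have := path_trace_ideal (repr_qpi (@brauer_rel k S n) u).
by rewrite -scaleN1r path_traceD path_traceZ mulN1r => /subr0_eq.
Qed.

Lemma brauer_trace_is_linear : linear_for *%R brauer_trace.
Proof.
move=> c x y; have [u ->] := qpi_surj x; have [v ->] := qpi_surj y.
have -> : c *: qpi (@brauer_rel k S n) u + qpi (@brauer_rel k S n) v =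
    qpi (@brauer_rel k S n) (c *: u + v).
  by rewrite qpiD; congr (_ + _); apply: qpiZ.
by rewrite !brauer_traceE path_traceD path_traceZ.
Qed.

Lemma brauer_trace_exists : exists tr : {scalar brauer k S n},
  forall u, tr (qpi (@brauer_rel k S n) u) = path_trace u.
Proof.
pose linear_tr := GRing.isLinear.Build k (brauer k S n) k *%R brauer_trace
  brauer_trace_is_linear.
pose tr : {scalar brauer k S n} := HB.pack brauer_trace linear_tr.
by exists tr; exact: brauer_traceE.
Qed.

End Trace.

(** * A spanning set and its dual *)

Lemma edge_partner (S : sgraph) (i : half S) :
  exists2 j, i != j & edge_of i = edge_of j.
Proof.
have := edge_of_card (edge_of i); rewrite (cardsD1 i) inE eqxx => -[] /eqP.
by move=> /cards1P[j /setP/(_ j)]; rewrite !inE eqxx eq_sym => /andP[? /eqP]; exists j.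
Qed.

Lemma edge_halves (S : sgraph) : exists h : edge S -> half S, cancel h (@edge_of S).
Proof.
suff /fin_all_exists[h hE] : forall e, exists i : half S, edge_of i = e by exists h.
move=> e; have /card_gt0P[i] : (0 < #|[set i | edge_of i == e]|)%N.
  by rewrite edge_of_card.
by rewrite inE => /eqP; exists i.
Qed.

Section Spanning.
Variables (k : fieldType) (S : sgraph) (n : int).
Hypothesis hn : compatible S n.
Local Notation next := (hnext S).
Local Notation Q := (sgraph_quiver S).
Local Notation cyc_path := (cyc_path n).
Local Notation cyc_length := (cyc_length n).
Implicit Types (i j : half S) (p q : qpath Q).

Definition path_class p : brauer k S n := qpi (@brauer_rel k S n) (pbasis k p).

Lemma path_class_comp p q r : pcomp p q = Some r ->
  path_class r = path_class p * path_class q.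
Proof.
by move=> e; rewrite /path_class -(pbasisM_some k e); apply: esym; apply: qpiM.
Qed.

Lemma path_class_rotation i l m : path_class (rotation i (l + m)) =
  path_class (rotation (iter l next i) m) * path_class (rotation i l).
Proof. exact/path_class_comp/rotation_comp. Qed.

Lemma path_class_broken i j : next i != j -> edge_of (next i) = edge_of j ->
  path_class (rotation j 1) * path_class (rotation i 1) = 0.
Proof.
move=> ij eij; rewrite !rotation1.
transitivity (qpi (@brauer_rel k S n) (arrow k (j : qarr Q) * arrow k (i : qarr Q))).
  exact: qpiM.
rewrite -(qpi0 (@brauer_rel k S n)); apply/qpi_eq; rewrite subr0.
by rewrite -[_ * _]mulr1 -[_ * _ * 1]mul1r mulrA; constructor; constructor.
Qed.

Lemma path_class_cyc i j : i != j -> edge_of i = edge_of j ->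
  path_class (cyc_path i) = (-1) ^ (n - 1) *: path_class (cyc_path j).
Proof.
move=> ij eij; transitivity (qpi (@brauer_rel k S n)
    ((-1) ^ (n - 1) *: pbasis k (cyc_path j))); last by apply: esym; apply: qpiZ.
apply/qpi_eq; rewrite -!(cycE hn) -[_ - _]mulr1 -[_ * 1]mul1r mulrA.
by constructor; constructor.
Qed.

(** Past c_i, the next arrow is a_i again.  Now a_i c_i = +- a_i c_j for the other
half j of the edge, and the last arrow a_(j-1) of c_j ends in j rather than in
i, so that a_i a_(j-1) = 0. *)
Lemma path_class_overlong i l : (cyc_length i < l)%N ->
  path_class (rotation i l) = 0.
Proof.
move=> Ll; rewrite -(subnKC Ll) path_class_rotation -addn1.
rewrite path_class_rotation iter_cyc_length.
have [j ij eij] := edge_partner i; rewrite (path_class_cyc ij eij) pzscalerAr.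
(* The halfedge before [j], reached one step before closing the cycle. *)
have nx : next (iter (cyc_length j).-1 next j) = j.
  by rewrite -iterS prednK ?cyc_length_gt0 // iter_cyc_length.
rewrite -[cyc_path j]/(rotation j _) -[in rotation j _](prednK (cyc_length_gt0 hn j)).
rewrite -[_.-1.+1]addn1 path_class_rotation [path_class (rotation i 1) * _]mulrA.
by rewrite path_class_broken ?nx 1?eq_sym // mul0r scaler0 mulr0.
Qed.

(** Prepend the arrows one by one: either the new arrow extends the rotation, or
it meets the first arrow of the rotation in a vanishing product. *)
Lemma path_class_trichotomy p : [\/ path_class p = 0, exists v, p = pnil v
  | exists i l, (0 < l <= cyc_length i)%N /\ p = rotation i l].
Proof.
suff [->|pv|[i [l ->]]] : [\/ path_class p = 0, exists v, p = pnil v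
  | exists i l, p = rotation i l.+1].
- by constructor 1.
- by constructor 2.
- have [lL|Ll] := leqP l.+1 (cyc_length i); last first.
    by constructor 1; apply: path_class_overlong.
  by constructor 3; exists i, l.+1.
elim: {p}(parrs p) {-2}p (erefl (parrs p)) => [|i s IH] p pE.
  by constructor 2; exists (pstart p); apply: parrs_nil.
have : is_walk (pstart p) (parrs p) := valP p.
rewrite pE => /= /andP[/eqP ip ws].
pose p' : qpath Q := exist _ (_ : qvert Q * seq (qarr Q)) (ws : is_path (_, _)).
have pp' : path_class p = path_class p' * path_class (rotation i 1).
  by apply/path_class_comp/pcomp_Some.
case: (IH p' erefl) => [z|[v p'v]|[j [l p'j]]].
- by constructor 1; rewrite pp' z mul0r.
- constructor 3; exists i, 0%N; apply: qpath_eq => //=; rewrite pE.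
  by have := congr1 (@parrs Q) p'v; rewrite /parrs /= => ->.
have sE : s = traject next j l.+1 by exact: (congr1 (@parrs Q) p'j).
have [ij|ij] := eqVneq (next i) j.
  constructor 3; exists i, l.+1; apply: qpath_eq => //=.
  by rewrite pE sE /parrs /= ij.
constructor 1; rewrite pp' p'j -add1n path_class_rotation -mulrA.
rewrite path_class_broken ?mulr0 //.
exact: (congr1 (@pstart Q) p'j).
Qed.

(* One half of each edge, so that c_i and c_j = +- c_i are counted only once. *)
Variable h : edge S -> half S.
Hypothesis hK : cancel h (@edge_of S).

(** The pairs (i, l) stand for the rotations of length l + 1, with 0 < l + 1 < L_i;
the two copies of the edges stand for the idempotents and for the cycles. *)
Definition basis_index : finType :=
  ({i : half S & 'I_(cyc_length i).-1} + (edge S + edge S))%type.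

Definition basis_path (y : basis_index) : qpath Q :=
  match y with
  | inl il => rotation (tag il) (tagged il).+1
  | inr (inl e) => pnil (e : qvert Q)
  | inr (inr e) => cyc_path (h e)
  end.

(** The complement of a path of the basis to a cycle. *)
Definition dual_path (y : basis_index) : qpath Q :=
  match y with
  | inl il => rotation (iter (tagged il).+1 next (tag il))
                (cyc_length (tag il) - (tagged il).+1)
  | inr (inl e) => cyc_path (h e)
  | inr (inr e) => pnil (e : qvert Q)
  end.

(** The halfedge at which the cycle made of a path and its complement starts. *)
Definition dual_cycle (y : basis_index) : half S :=
  match y with
  | inl il => iter (tagged il).+1 next (tag il)
  | inr (inl e) | inr (inr e) => h e
  end.

Lemma path_class_basis p :
  path_class p = 0 \/ exists y c, path_class p = c *: path_class (basis_path y).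
Proof.
case: (path_class_trichotomy p) => [->|[v ->]|[i [l [/andP[l0 lL] ->]]]].
- by left.
- by right; exists (inr (inl v)), 1; rewrite scale1r.
right; move: lL; rewrite leq_eqVlt => /orP[/eqP lE|lL].
  exists (inr (inr (edge_of i))); rewrite lE /=.
  have [<-|ih] := eqVneq i (h (edge_of i)); first by exists 1; rewrite scale1r.
  by exists ((-1) ^ (n - 1)); apply: path_class_cyc; rewrite ?hK.
have lP : (l.-1 < (cyc_length i).-1)%N by lia.
exists (inl (existT (fun i => 'I_(cyc_length i).-1) i (Ordinal lP))), 1.
by rewrite scale1r /= prednK.
Qed.

Lemma dual_path_comp y :
  pcomp (basis_path y) (dual_path y) = Some (cyc_path (dual_cycle y)).
Proof.
case: y => [[i l]|[e|e]] /=.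
- have lL : (l.+1 <= cyc_length i)%N by have := ltn_ord l; lia.
  rewrite -iterS; set x := iter l.+1 _ _.
  have {1}-> : i = iter (cyc_length i - l.+1) next x.
    by rewrite -iterD subnK // iter_cyc_length.
  by rewrite rotation_comp subnK // /cyc_path cyc_length_iter.
- by apply: pcomp_Some; rewrite ?cats0 // pend_rotation iter_cyc_length hK.
- by apply: pcomp_Some; rewrite ?hK //= /pstart /= hK.
Qed.

(** If b b' = c_i and b' is the complement of some basis path, then b' determines
b: for b' of positive length it determines i and the length of b; and if b' is
a trivial path, then b is a cycle at its edge, of which the basis contains one. *)
Lemma dual_path_inj y z i :
  pcomp (basis_path y) (dual_path z) = Some (cyc_path i) -> y = z.
Proof.
move=> /rotation_split[l lL []].
case: z => [[j m]|[e|e]] /= dE.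
- have mL : (m.+1 < cyc_length j)%N by have := ltn_ord m; lia.
  have [|iE lE] := rotation_inj _ dE; first lia.
  have -> : iter l next i = j.
    by rewrite -iE -lE -iterS -iterD subnK 1?ltnW // iter_cyc_length.
  have -> : (cyc_length i - l)%N = m.+1.
    by rewrite -iE -lE -iterS cyc_length_iter subKn // ltnW.
  case: y => [[j' m']|[e|e]] //=.
  + by case/rotation_inj => // jE; case: _ / jE m mL dE lE iE => m _ _ _ _ [/val_inj->].
  + move=> /(rotation_inj (cyc_length_gt0 hn _))[/(congr1 cyc_length)]; lia.
- have [iE <-] := rotation_inj (cyc_length_gt0 hn _) dE.
  rewrite -iE subnn iter_cyc_length rotation0 hK.
  case: y => [[j m]|[e'|e']] //=.
    by move=> /(congr1 (@pstart Q)); rewrite /pstart /= => ->.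
  move=> /(congr1 (@parrs Q)); rewrite /parrs /=.
  by have := cyc_length_gt0 hn (h e'); case: cyc_length.
- have l0 : l = 0%N by have := congr1 (size \o @parrs Q) dE; rewrite /= size_traject.
  have eE : e = edge_of i by have := congr1 (@pstart Q) dE.
  rewrite l0 subn0; case: y => [[j m]|[e'|e']] /= E.
  + have [//|jE mE] := rotation_inj _ E.
    by have := ltn_ord m; have := congr1 cyc_length jE; lia.
  + have := congr1 (size \o @parrs Q) E; rewrite /= size_traject => L0.
    by have := cyc_length_gt0 hn i; rewrite -L0.
  + by rewrite eE -(cyc_path_inj hn E) hK.
Qed.

Variables (t : half S -> k) (tr : {scalar brauer k S n}).
Hypothesis tw : twist n t.
Hypothesis trE : forall u, tr (qpi (@brauer_rel k S n) u) = path_trace n t u.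

(** Scaling by t corrects tr(c_x) = t_x to 1, since t_x^2 = 1. *)
Definition dual_class (y : basis_index) : brauer k S n :=
  t (dual_cycle y) *: path_class (dual_path y).

Lemma dual_basis_orthonormal y z :
  tr (path_class (basis_path y) * dual_class z) = (y == z)%:R.
Proof.
rewrite /dual_class pzscalerAr linearZ /=.
have -> : path_class (basis_path y) * path_class (dual_path z) =
    qpi (@brauer_rel k S n) (pbasis k (basis_path y) * pbasis k (dual_path z)).
  exact: qpiM.
rewrite trE; have [<-|yz] := eqVneq y z.
  by rewrite (pbasisM_some _ (dual_path_comp y)) path_trace_cyc // (twist_sq tw).
apply/eqP; rewrite mulf_eq0; apply/orP; right; apply: contraNT yz.
by move=> /path_trace_mul_neq0[i /dual_path_inj ->].
Qed.

(** Both sides are linear in [x], and each path is 0 or a multiple of a basis path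
in the algebra, for which this is orthonormality. *)
Lemma dual_basis_expansion x :
  x = \sum_y tr (x * dual_class y) *: path_class (basis_path y).
Proof.
have trZ c y : tr (c *: y) = c * tr y by rewrite linearZ.
have [u ->] := qpi_surj x; elim/pathalg_ind: u => [|u v IH IH'|c u IH|p].
- by rewrite qpi0 big1 // => y _; rewrite mul0r linear0 scale0r.
- rewrite qpiD {1}IH {1}IH' -big_split; apply: eq_bigr => y _ /=.
  by rewrite mulrDl linearD scalerDl.
- have -> : qpi (@brauer_rel k S n) (c *: u) = c *: qpi (@brauer_rel k S n) u.
    by apply: esym; apply: qpiZ.
  rewrite {1}IH scaler_sumr; apply: eq_bigr => y _.
  by rewrite scalerA pzscalerAl trZ.
rewrite -/(path_class p); have [->|[z [c ->]]] := path_class_basis p.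
  by rewrite big1 // => y _; rewrite mul0r linear0 scale0r.
rewrite (bigD1 z) //= big1 ?addr0 => [|y yz]; rewrite pzscalerAl trZ.
  by rewrite dual_basis_orthonormal eqxx mulr1.
by rewrite dual_basis_orthonormal eq_sym (negPf yz) mulr0 scale0r.
Qed.

End Spanning.

Theorem proposition2p15 (k : fieldType) (S : sgraph) (n : int)
    (hn : compatible S n) :
  ~~ (2 %| n)%Z \/ orientable S ->
  calabi_yau n (brauer_grading k hn).
Proof.
move=> /(twist_exists k)[t tw]; have [h hK] := edge_halves S.
have [tr trE] := brauer_trace_exists hn tw.
have trME u v : tr (qpi (@brauer_rel k S n) u * qpi (@brauer_rel k S n) v) =
    path_trace n t (u * v).
  by rewrite -trE; congr (tr _); apply: qpiM.
have expand := dual_basis_expansion hn hK tw trE.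
split; first exact: dual_finite_dim expand.
exists tr; split.
- by move=> e a en [u hu ->]; rewrite trE (path_trace_piece hn _ en hu).
- by move=> p q a b [u hu ->] [v hv ->]; rewrite !trME (path_traceC_homog hn tw hu hv).
- by move=> a; exact: dual_nondegenerate expand a.
(* By symmetry up to sign, [b] is also orthogonal to everything on its right. *)
move=> b hb; apply: (dual_nondegenerate expand) => a.
have [u uE] := qpi_surj b; have [v ->] := qpi_surj a; subst b.
rewrite trME; elim/pathalg_ind: v => [|v w IH IH'|c v IH|p].
- by rewrite mulr0 path_trace0.
- by rewrite mulrDr path_traceD IH IH' addr0.
- by rewrite pzscalerAr path_traceZ IH mulr0.
by rewrite path_traceC // -trME hb mulr0.
Qed.
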